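(* Consider any instance of the unconstrained traveling tournament problem (UTTP) with $n\ge 4$ teams, $n$ even, and a distance matrix $D=(d_{ij})$ satisfying $d_{ij}\ge 0$, $d_{ii}=0$, $d_{ij}=d_{ji}$ and $d_{ij}+d_{jk}\ge d_{ik}$. The double round-robin schedule output by the algorithm described in the context has total traveling distance at most $2.75$ times the minimum total traveling distance over all double round-robin schedules of the instance; that is, the algorithm is a $2.75$-approximation algorithm for the UTTP.
   Context: UTTP. A set $T$ of $n$ teams ($n\ge4$ even) is given; each team has a home venue and $d_{ij}$ is the distance between the home venues of teams $i$ and $j$, with $d_{ij}\ge0$, $d_{ii}=0$, $d_{ij}=d_{ji}$, $d_{ij}+d_{jk}\ge d_{ik}$. A game is an ordered pair of distinct teams ''$i$ at $j$'', played at the home venue of $j$ (a home game for $j$, an away game for $i$). A double round-robin schedule uses $2(n-1)$ slots $0,1,\dots,2n-3$; in every slot each team plays exactly one game, and every ordered pair of distinct teams is played exactly once. Each team is at its home venue before the first slot, travels in slot order to the venue of each of its games (consecutive away games are travelled directly between the opponents' venues), and after the last slot returns to its home venue. The total traveling distance is the sum over all teams of the distances travelled. The UTTP asks for a double round-robin schedule minimizing the total traveling distance (no other constraints). Algorithm. Let $G$ be the complete graph whose vertex set $V$ is in bijection with the teams (vertex = home venue), with edge $\{v,v'\}$ of length $d_{vv'}$. 1. Let $v^*$ be a vertex attaining $\min_{v\in V}\sum_{v'\in V\setminus\{v\}}d_{vv'}$; the team of $v^*$ is named $n-1$. 2. Using Christofides' 1.5-approximation algorithm for the metric traveling salesman problem,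 construct a Hamilton cycle $(v_0,v_1,\dots,v_{n-2})$ on the complete graph induced by $V\setminus\{v^*\}$; the team with home venue $v_i$ is named $i$. So $T=\{0,\dots,n-1\}$. 3. For $t\in T$ and $s\in\{0,\dots,n-2\}$ define the opponent $K^*(t,s)$ by: $K^*(t,s)=s-t \pmod{n-1}$ if $t\ne n-1$ and $s-t\not\equiv t \pmod{n-1}$; $K^*(t,s)=n-1$ if $t\ne n-1$ and $s-t\equiv t\pmod{n-1}$; $K^*(n-1,s)=s/2$ if $s$ is even; $K^*(n-1,s)=(s+n-1)/2$ if $s$ is odd. 4. Form a double round-robin schedule $K^*_{\mathrm{DRR}}$ on slots $0,\dots,2n-3$: in slots $s$ and $s+n-1$ ($s\in\{0,\dots,n-2\}$) team $t$ plays against $K^*(t,s)$. Home/away: for $t\in\{0,\dots,n/2-1\}$, the games in slots $2t,2t+1,\dots,n+2t-2$ are home games and the others away; for $t\in\{n/2,\dots,n-2\}$, the games in slots $2t-n+2,\dots,2t$ are away games and the others home; for team $n-1$, games in slots $0,\dots,n-2$ are away and the others home. 5. For $m\in\{0,\dots,2n-3\}$ let $K^*_{\mathrm{DRR}}(m)$ be the schedule whose games in slot $s$ are the games of $K^*_{\mathrm{DRR}}$ in slot $s+m \pmod{2n-2}$. 6. Output a schedule $K^*_{\mathrm{DRR}}(m)$ of minimum total traveling distance. *)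

(* Defs.v *)
From mathcomp Require Import all_boot all_order all_algebra.

Set Implicit Arguments.
Unset Strict Implicit.
Unset Printing Implicit Defensive.

Import Order.TTheory GRing.Theory Num.Theory.
Local Open Scope ring_scope.

(* A game "i at j", played at the home venue of j, is the pair (i, j). *)
Definition game (T : finType) : finType := (T * T)%type.

Definition nb_slots (T : finType) : nat := (#|T|.-1).*2.

Definition schedule (T : finType) : finType :=
  {ffun 'I_(nb_slots T) -> {set game T}}.

Definition double_round_robin (T : finType) (S : schedule T) : Prop :=
  [/\ forall s (g : game T), g \in S s -> g.1 != g.2,
      forall s (t : T),
        #|[set g : game T in S s | (t == g.1) || (t == g.2)]| = 1%N
    & forall i j : T, i != j -> #|[set s | (i, j) \in S s]| = 1%N].

(* The team stays at its own venue in a slot where it has no away game. *)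
Definition venue (T : finType) (S : schedule T) (t : T) (s : 'I_(nb_slots T)) : T :=
  odflt t [pick j | (t, j) \in S s].

Definition walk_length (R : realFieldType) (T : Type) (d : T -> T -> R)
    (x : T) (p : seq T) : R :=
  \sum_(l <- pairmap d x p) l.

Definition team_distance (R : realFieldType) (T : finType) (d : T -> T -> R)
    (S : schedule T) (t : T) : R :=
  walk_length d t (rcons [seq venue S t s | s <- enum 'I_(nb_slots T)] t).

Definition total_distance (R : realFieldType) (T : finType) (d : T -> T -> R)
    (S : schedule T) : R :=
  \sum_(t : T) team_distance d S t.

Definition is_min_total_distance (R : realFieldType) (T : finType)
    (d : T -> T -> R) (opt : R) : Prop :=
  (exists2 S : schedule T, double_round_robin S & total_distance d S = opt)
  /\ (forall S : schedule T, double_round_robin S -> opt <= total_distance d S).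

(** * Christofides' algorithm

    An edge is a set of two vertices, a simple graph is a set of edges. *)

(* The order in which [enum] lists the two ends is irrelevant when d is
   symmetric: see [edge_length2]. *)
Definition edge_length (R : realFieldType) (T : finType) (d : T -> T -> R)
    (e : {set T}) : R :=
  if enum e is [:: x; y] then d x y else 0.

Lemma edge_length2 (R : realFieldType) (T : finType) (d : T -> T -> R)
    (d_sym : forall i j, d i j = d j i) (x y : T) :
  x != y -> edge_length d [set x; y] = d x y.
Proof.
move=> xDy; rewrite /edge_length.
have Us := enum_uniq [set x; y].
have Ms : enum [set x; y] =i [set x; y] by move=> z; rewrite mem_enum.
have := cards2 x y; rewrite xDy cardE.
case: (enum _) Us Ms => [|a [|b [|? ?]]] //= aDb Mab _.
have := Mab a; have := Mab b; rewrite !inE !eqxx /= orbT.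
move: aDb; rewrite inE andbT => aDb /esym bE /esym aE.
by case/orP: aE aDb => /eqP->; case/orP: bE => /eqP->; rewrite ?eqxx.
Qed.

Definition edges_length (R : realFieldType) (T : finType) (d : T -> T -> R)
    (E : {set {set T}}) : R :=
  \sum_(e in E) edge_length d e.

Definition adjacent (T : finType) (E : {set {set T}}) : rel T :=
  fun x y => [set x; y] \in E.

Definition spanning_tree (T : finType) (A : {set T}) (E : {set {set T}}) : Prop :=
  [/\ forall e, e \in E -> (e \subset A) && (#|e| == 2%N),
      {in A &, forall x y, connect (adjacent E) x y}
    & forall c : seq T, uniq c -> (2 < size c)%N -> ~~ cycle (adjacent E) c].

Definition min_spanning_tree (R : realFieldType) (T : finType)
    (d : T -> T -> R) (A : {set T}) (E : {set {set T}}) : Prop :=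
  spanning_tree A E /\
  forall E', spanning_tree A E' -> edges_length d E <= edges_length d E'.

Definition odd_vertices (T : finType) (A : {set T}) (E : {set {set T}}) : {set T} :=
  [set x in A | odd #|[set e in E | x \in e]|].

Definition perfect_matching (T : finType) (A : {set T}) (M : {set {set T}}) : Prop :=
  partition M A /\ forall e, e \in M -> #|e| = 2%N.

Definition min_perfect_matching (R : realFieldType) (T : finType)
    (d : T -> T -> R) (A : {set T}) (M : {set {set T}}) : Prop :=
  perfect_matching A M /\
  forall M', perfect_matching A M' -> edges_length d M <= edges_length d M'.

Definition circuit_edges (T : finType) (w : seq T) : seq {set T} :=
  [seq [set p.1; p.2] | p <- zip w (rot 1 w)].

(* The multigraph is the disjoint union of E and M: an edge lying in both is
   traversed twice. *)
Definition eulerian_circuit (T : finType) (E M : {set {set T}}) (w : seq T) : Prop :=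
  perm_eq (circuit_edges w) (enum E ++ enum M).

(* Which occurrence of a repeated vertex is kept is left free. *)
Definition shortcut (T : finType) (w c : seq T) : Prop :=
  [/\ subseq c w, uniq c & c =i w].

(* c is a Hamilton cycle that Christofides' algorithm can return on the
   complete graph with vertex set A; all ties are left free. *)
Definition christofides (R : realFieldType) (T : finType) (d : T -> T -> R)
    (A : {set T}) (c : seq T) : Prop :=
  exists E M w,
    [/\ min_spanning_tree d A E,
        min_perfect_matching d (odd_vertices A E) M,
        eulerian_circuit E M w
      & shortcut w c].

(** * The schedule K*_DRR

    Teams are identified here with their names 0, ..., n - 1. *)

(* s + (n - 1) - t stands for s - t modulo n - 1, avoiding truncation. *)
Definition Kstar (n t s : nat) : nat :=
  if t == n.-1 then (if odd s then (s + n.-1)./2 else s./2)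
  else if s == (t + t)%N %[mod n.-1] then n.-1
  else ((s + n.-1 - t) %% n.-1)%N.

Definition plays_home (n t s : nat) : bool :=
  if (t < n./2)%N then (2 * t <= s <= n + 2 * t - 2)%N
  else if (t < n.-1)%N then ~~ (2 * t - n + 2 <= s <= 2 * t)%N
  else (n.-1 <= s)%N.

(* The name n - 1 = size c is given to vstar, the name i < n - 1 to the i-th
   vertex of c. *)
Definition team_named (T : finType) (vstar : T) (c : seq T) (i : nat) : T :=
  nth vstar (rcons c vstar) i.

Definition Kdrr_game (T : finType) (vstar : T) (c : seq T) (t s : nat) : game T :=
  let team := team_named vstar c in
  let opponent := Kstar #|T| t (s %% #|T|.-1) in
  if plays_home #|T| t s then (team opponent, team t) else (team t, team opponent).

Definition Kdrr (T : finType) (vstar : T) (c : seq T) (m : nat) : schedule T :=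
  [ffun s : 'I_(nb_slots T) =>
    [set Kdrr_game vstar c t ((s + m) %% nb_slots T) | t : 'I_#|T|]].

Definition star_center (R : realFieldType) (T : finType) (d : T -> T -> R)
    (v : T) : Prop :=
  forall u, \sum_(v' | v' != v) d v v' <= \sum_(u' | u' != u) d u u'.

(* S is a schedule that the algorithm can return, whatever the choices made
   between equally good candidates. *)
Definition uttp_output (R : realFieldType) (T : finType) (d : T -> T -> R)
    (S : schedule T) : Prop :=
  exists (vstar : T) (c : seq T) (m : 'I_(nb_slots T)),
    [/\ star_center d vstar,
        christofides d [set~ vstar] c,
        S = Kdrr vstar c m
      & forall m' : 'I_(nb_slots T),
          total_distance d (Kdrr vstar c m) <= total_distance d (Kdrr vstar c m')].

(* Main.v *)
Require Import Defs.
From mathcomp Require Import all_boot all_order all_algebra.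
From mathcomp Require Import zify ring lra.

(* Write n = 2 h, let L be the length of a shortcut Hamilton tour of a team with
   least travel in an optimal schedule, so that n L <= OPT, and let tau be the
   length of the tour of Christofides' algorithm, so that tau <= 3/2 L.
   For a fixed team, the venues in all Kdrr m form one cyclic sequence, cut open
   at slot m: cutting between consecutive venues a and b costs
   d(t, a) + d(b, t) - d(a, b) beyond the cyclic length C_t. Hence summing over the
   N = 2n - 2 values of m gives (N - 1) C_t + 2 sum_v d(t, v) for the team t.
   Up to the detour through v*, C_t is the length of the tour:
   C_t <= tau + 2 d(v*, t), while C_{v*} <= 2 sum_v d(v*, v) =: 2 Delta.
   Measuring all distances along a tour of length L gives
   n Delta <= sum_{u,v} d(u, v) <= h^2 L, and the minimum over m is at most the
   average. *)

Set Implicit Arguments.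
Unset Strict Implicit.
Unset Printing Implicit Defensive.

Import Order.TTheory GRing.Theory Num.Theory.
Local Open Scope ring_scope.

(** * Arithmetic of the schedule *)

(** Conditions that themselves contain a conditional are left for later, so splitting goes from the
    inside out; [lia] prunes impossible branches at once, which keeps the case tree small. *)
Ltac case_if_lia :=
  repeat match goal with
  | |- context [if ?b then _ else _] =>
      lazymatch b with
      | context [if _ then _ else _] => fail
      | _ => case: (boolP b) => ?; try (exfalso; lia)
      end
  end; try lia.

Lemma modn_lt_double (M x : nat) :
  (x < M + M)%N -> (x %% M)%N = (if x < M then x else x - M)%N.
Proof.
move=> xlt; case: ltnP => [/modn_small //|Mx].
by rewrite -{1}(subnK Mx) modnDr modn_small // ltn_subLR.
Qed.

Section Kstar.

Variable n : nat.
Hypotheses (n_ge4 : (4 <= n)%N) (n_even : ~~ odd n).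

(** All residues are taken of numbers below 2 (n - 1), so each reduction is at most one subtraction,
    and [lia] can handle the resulting linear conditionals. *)
Lemma KstarE (t s : nat) : (t < n)%N -> (s < n.-1)%N ->
  Kstar n t s = (if t == n.-1 then (if odd s then (s + n.-1)./2 else s./2)
    else if (s == t + t) || (s + n.-1 == t + t) then n.-1
    else if t <= s then s - t else s + n.-1 - t)%N.
Proof.
move=> tn sn; rewrite /Kstar; case: eqP => // tM.
rewrite !modn_lt_double; case_if_lia.
Qed.

Lemma Kstar_lt (t s : nat) : (t < n)%N -> (s < n.-1)%N -> (Kstar n t s < n)%N.
Proof. by move=> tn sn; rewrite KstarE //; case_if_lia. Qed.

Lemma Kstar_neq (t s : nat) : (t < n)%N -> (s < n.-1)%N -> Kstar n t s != t.
Proof. by move=> tn sn; rewrite KstarE //; case_if_lia. Qed.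

Lemma KstarK (t s : nat) : (t < n)%N -> (s < n.-1)%N ->
  Kstar n (Kstar n t s) s = t.
Proof.
move=> tn sn; rewrite (KstarE (Kstar_lt tn sn) sn) KstarE //; case_if_lia.
Qed.

Lemma Kstar_inj (t s s' : nat) : (t < n)%N -> (s < n.-1)%N -> (s' < n.-1)%N ->
  Kstar n t s = Kstar n t s' -> s = s'.
Proof. by move=> tn sn sn'; rewrite !KstarE //; case_if_lia. Qed.

Lemma Kstar_surj (t u : nat) : (t < n)%N -> (u < n)%N -> t != u ->
  exists2 s, (s < n.-1)%N & Kstar n t s = u.
Proof.
move=> tn un tu.
(* Two teams with names below n - 1 meet in the slot congruent to the sum of their names modulo n -
   1. The opponent of team n - 1 would meet itself by this rule, so its name is counted twice. *)
pose a := (if u == n.-1 then t else u)%N; pose b := (if t == n.-1 then u else t)%N.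
exists (if a + b < n.-1 then a + b else a + b - n.-1)%N.
  by rewrite /a /b; case_if_lia.
by rewrite KstarE /a /b; case_if_lia.
Qed.

(** The two meetings of a pair are n - 1 slots apart; this puts them at different venues. *)
Lemma plays_home_shift (t s : nat) : (t < n)%N -> (s < n.-1)%N ->
  plays_home n t (s + n.-1) = ~~ plays_home n t s.
Proof. by move=> tn sn; rewrite /plays_home; case_if_lia. Qed.

(** Home and away are prescribed team by team; this is the consistency that makes both participants
    describe the same ordered game. *)
Lemma plays_home_Kstar (t s : nat) : (t < n)%N -> (s < (n.-1).*2)%N ->
  plays_home n (Kstar n t (s %% n.-1)) s = ~~ plays_home n t s.
Proof.
move=> tn sN; have slot r : (r < n.-1)%N ->
    plays_home n (Kstar n t r) r = ~~ plays_home n t r.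
  by move=> rM; rewrite KstarE // /plays_home; case_if_lia.
(* The second half of the schedule reduces to the first, since the shift by n - 1 negates both
   sides. *)
case: (ltnP s n.-1) => [sM|Ms]; first by rewrite modn_small // slot.
have rM : (s - n.-1 < n.-1)%N by lia.
rewrite -(subnK Ms) modnDr modn_small //.
by rewrite !plays_home_shift ?Kstar_lt // slot.
Qed.

End Kstar.

(** * The schedules Kdrr are double round-robins *)

(** [N - m %% N] represents -m modulo N without truncation; this locates the slot of a shifted
    schedule that holds a given slot of the unshifted one. *)
Lemma modn_shift_eq (N m s s' : nat) : (s < N)%N -> (s' < N)%N ->
  ((s + m) %% N == s')%N = (s == (s' + (N - m %% N)) %% N)%N.
Proof.
move=> slt s'lt.
have -> : (s == (s' + (N - m %% N)) %% N)%N = (s == s' + (N - m %% N) %[mod N])%N.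
  by rewrite (modn_small slt).
rewrite -(eqn_modDr m) -addnA.
have -> : (N - m %% N + m = (m %/ N).+1 * N)%N.
  have mlt : (m %% N < N)%N by rewrite ltn_mod (leq_ltn_trans _ slt).
  by rewrite {2}(divn_eq m N) mulSn; lia.
by rewrite [(s' + _)%N]addnC modnMDl (modn_small s'lt).
Qed.

Section Venue.

Variables (T : finType) (S : schedule T).
Hypothesis drrS : double_round_robin S.

Lemma venueE (t j : T) s : (t, j) \in S s -> venue S t s = j.
Proof.
case: drrS => neq one _ tj; rewrite /venue;
  case: pickP => [k tk|/(_ j)]; last by rewrite tj.
have /eqP/cards1P[g Eg] := one s t.
have : (t, j) \in [set g] by rewrite -Eg inE tj eqxx.
have : (t, k) \in [set g] by rewrite -Eg inE tk eqxx.
by rewrite !inE => /eqP <- /eqP[].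
Qed.

Lemma venue_away (t j : T) s : t != j -> (venue S t s == j) = ((t, j) \in S s).
Proof.
move=> tj; apply/eqP/idP; last exact: venueE.
rewrite /venue; case: pickP => [k tk <- //|_ /= tj']; by rewrite tj' eqxx in tj.
Qed.

(** Each other venue is visited in exactly one slot, and the slots spent at home contribute F t =
    0. *)
Lemma sum_venue (R : realFieldType) (F : T -> R) (t : T) :
  F t = 0 -> \sum_s F (venue S t s) = \sum_v F v.
Proof.
move=> Ft0; rewrite (partition_big (venue S t) predT) //=.
apply: eq_bigr => v _; rewrite (eq_bigr (fun=> F v)) => [|s /eqP-> //].
case: (eqVneq t v) => [<-|tv]; first by rewrite Ft0 big1.
rewrite sumr_const; suff -> : #|[pred s | venue S t s == v]| = 1%N by [].
case: drrS => _ _ /(_ _ _ tv) <-; rewrite -[RHS]cardsE.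
by apply: eq_card => s; rewrite !inE venue_away.
Qed.

Lemma venue_onto (t v : T) : v \in t :: [seq venue S t s | s <- enum 'I_(nb_slots T)].
Proof.
rewrite inE; case: eqVneq => //= vt.
case: drrS => _ _ /(_ t v); rewrite eq_sym => /(_ vt)/eqP/cards1P[s Es].
have : s \in [set s] by rewrite inE.
rewrite -Es inE => tv; apply/mapP; exists s; first by rewrite mem_enum.
by rewrite (venueE tv).
Qed.

End Venue.

Section Kdrr.

Variables (T : finType) (vstar : T) (c : seq T).
Hypotheses (n_ge4 : (4 <= #|T|)%N) (n_even : ~~ odd #|T|).
Hypotheses (c_uniq : uniq c) (c_all : c =i [set~ vstar]).

Let n := #|T|.
Let team := team_named vstar c.

Lemma size_tour : size c = n.-1.
Proof.
have := card_uniqP c_uniq; rewrite (eq_card c_all) => <-.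
by rewrite cardsC1.
Qed.

Lemma team_last : team n.-1 = vstar.
Proof. by rewrite /team /team_named nth_rcons size_tour ltnn eqxx. Qed.

Lemma team_inj i j : (i < n)%N -> (j < n)%N -> team i = team j -> i = j.
Proof.
move=> ilt jlt /eqP; rewrite nth_uniq ?size_rcons ?size_tour; try lia.
by rewrite rcons_uniq c_uniq c_all !inE eqxx.
Qed.

Lemma team_onto v : exists2 i, (i < n)%N & team i = v.
Proof.
have : v \in rcons c vstar.
  by rewrite mem_rcons inE c_all !inE; case: eqP.
by case/(nthP vstar) => i; rewrite size_rcons size_tour => ilt <-; exists i => //; lia.
Qed.

Let opp t s := Kstar n t (s %% n.-1).

Let slot_mod s : (s %% n.-1 < n.-1)%N.
Proof. by rewrite ltn_mod; lia. Qed.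

Let opp_lt t s : (t < n)%N -> (opp t s < n)%N.
Proof. by move=> tn; apply: Kstar_lt. Qed.

Lemma Kdrr_gameE t s : (t < n)%N -> (s < (n.-1).*2)%N ->
  Kdrr_game vstar c (opp t s) s = Kdrr_game vstar c t s.
Proof.
move=> tn sn; rewrite /Kdrr_game plays_home_Kstar // KstarK //.
by case: plays_home.
Qed.

(** The image ranges over teams, so each game is produced twice, by its host and by its visitor;
    membership is read off the host. *)
Lemma mem_Kdrr m (s : 'I_(nb_slots T)) (t u : nat) : (t < n)%N -> (u < n)%N ->
  ((team u, team t) \in Kdrr vstar c m s) =
  (opp t ((s + m) %% nb_slots T) == u) && plays_home n t ((s + m) %% nb_slots T).
Proof.
move=> tn un; rewrite ffunE; set s' := (_ %% _)%N.
have s'lt : (s' < (n.-1).*2)%N.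
  by rewrite ltn_mod double_gt0; move: (n_ge4); rewrite /n; lia.
apply/imsetP/andP => [[i _]|[/eqP Ku home]].
  rewrite /Kdrr_game -/n -/(opp i s') -/team.
  case: ifP => home [] /(team_inj un)-Eu /(team_inj tn)-Et.
    by rewrite Et ?opp_lt // Eu ?opp_lt.
  rewrite Eu // Et ?opp_lt // /opp KstarK // eqxx; split=> //.
  by rewrite plays_home_Kstar // home.
exists (Ordinal tn) => //; rewrite /Kdrr_game /= -/n home.
by rewrite -/(opp t s') Ku.
Qed.

Lemma Kdrr_double_round_robin m : double_round_robin (Kdrr vstar c m).
Proof.
have Ngt0 : (0 < (n.-1).*2)%N by rewrite double_gt0; lia.
have slot_lt s : (s %% nb_slots T < (n.-1).*2)%N by rewrite ltn_mod.
split.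
- move=> s [u t] /=; have [i ilt <-] := team_onto u; have [j jlt <-] := team_onto t.
  rewrite mem_Kdrr // => /andP[/eqP oE _]; apply/eqP => /(team_inj ilt jlt) ij.
  have := Kstar_neq n_ge4 n_even jlt (slot_mod ((s + m) %% nb_slots T)).
  by rewrite -/n -/(opp _ _) oE ij eqxx.
- move=> s v; have [t tn <-] := team_onto v.
  set s' := ((s + m) %% nb_slots T)%N; have s'lt : (s' < (n.-1).*2)%N by apply: slot_lt.
  apply/eqP/cards1P; exists (Kdrr_game vstar c t s').
  apply/setP => g; rewrite inE in_set1 ffunE -/s'.
  apply/andP/eqP => [[/imsetP[i _ ->]]|->].
    rewrite /Kdrr_game -/n -/(opp i s') -/team => it.
    have : t = i \/ t = opp i s'.
      by move: it; case: ifP => _ /= /orP[] /eqP/team_inj-> //; auto; rewrite ?opp_lt.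
    case=> -> //; rewrite -[RHS]/(Kdrr_game vstar c (opp i s') s') Kdrr_gameE //.
  split; first by apply/imsetP; exists (Ordinal tn).
  by rewrite /Kdrr_game; case: ifP => _ /=; rewrite eqxx ?orbT.
- move=> u' t'; have [u un <-] := team_onto u'; have [t tn <-] := team_onto t' => tu.
  have tu' : t != u by apply: contraNneq tu => ->.
  have [s0 s0lt Ks0] := Kstar_surj n_ge4 n_even tn un tu'.
  (* The pair meets in slots s0 and s0 + n - 1 of the unshifted schedule, and t is the host in
     exactly one of them. *)
  pose s1 := if plays_home n t s0 then s0 else (s0 + n.-1)%N.
  have s1lt : (s1 < (n.-1).*2)%N by rewrite /s1; case: ifP => _; lia.
  have s1home : plays_home n t s1.
    by rewrite /s1; case: ifP => // /negbT home; rewrite plays_home_shift // home.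
  have s1mod : (s1 %% n.-1 = s0)%N.
    by rewrite /s1; case: ifP => _; rewrite ?modnDr modn_small.
  have good s : (s < (n.-1).*2)%N -> (opp t s == u) && plays_home n t s = (s == s1).
    move=> slt; apply/andP/eqP => [[/eqP oE home]|->]; last first.
      by rewrite /opp s1mod Ks0 eqxx.
    have E : (s %% n.-1 = s0)%N by apply: (Kstar_inj n_ge4 n_even tn) => //; rewrite Ks0.
    move: (divn_eq s n.-1); rewrite E => Es.
    have := plays_home_shift n_ge4 n_even tn s0lt.
    have q2 : (s %/ n.-1 < 2)%N by rewrite ltn_divLR; lia.
    move: Es home; rewrite /s1; case: (s %/ n.-1)%N q2 => [|[|//]] _.
      by rewrite mul0n add0n => -> ->.
    by rewrite mul1n addnC => -> ->; case: plays_home.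
  pose s2 := ((s1 + (nb_slots T - m %% nb_slots T)) %% nb_slots T)%N.
  have s2lt : (s2 < nb_slots T)%N by rewrite ltn_mod.
  apply/eqP/cards1P; exists (Ordinal s2lt); apply/setP => s; rewrite !inE mem_Kdrr //.
  rewrite good // -(inj_eq val_inj) /= /s2.
  by rewrite modn_shift_eq.
Qed.

Lemma venue_Kdrr m (s : 'I_(nb_slots T)) t : (t < n)%N ->
  venue (Kdrr vstar c m) (team t) s =
  let s' := ((s + m) %% nb_slots T)%N in
  team (if plays_home n t s' then t else opp t s').
Proof.
move=> tn; set s' := (_ %% _)%N => /=.
have s'lt : (s' < (n.-1).*2)%N.
  by rewrite ltn_mod double_gt0; move: (n_ge4); rewrite /n; lia.
case: ifP => [home|/negbT away].
  rewrite /venue; case: pickP => //= v; have [i ilt <-] := team_onto v.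
  rewrite mem_Kdrr // -/s' => /andP[/eqP Et ihome].
  by move: home; rewrite -Et /opp plays_home_Kstar // ihome.
apply: (venueE (Kdrr_double_round_robin m)).
by rewrite mem_Kdrr ?opp_lt // -/s' /opp KstarK // eqxx plays_home_Kstar.
Qed.

End Kdrr.

(** * Lengths of periodic sequences *)

Lemma sum_periodic (R : zmodType) (F : nat -> R) (N m : nat) :
  (forall s, F (s + N)%N = F s) -> \sum_(s < N) F (s + m)%N = \sum_(s < N) F s.
Proof.
move=> FN; elim: m => [|m IHm]; first by apply: eq_bigr => s _; rewrite addn0.
rewrite -{}IHm; case: N FN => [|N] FN; first by rewrite !big_ord0.
rewrite big_ord_recr big_ord_recl /= addrC add0n.
congr (_ + _); last by apply: eq_bigr => s _; rewrite addnS.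
by rewrite addnS addnC -addnS FN.
Qed.

Definition cyclic_length (R : realFieldType) (T : Type) (d : T -> T -> R)
    (N : nat) (a : nat -> T) : R :=
  \sum_(s < N) d (a s) (a s.+1).

(** Isolates the step from the last slot back to slot m, the one that a route cut open at m does not
    travel. *)
Lemma cyclic_length_recr (R : realFieldType) (T : Type) (d : T -> T -> R)
    (N m : nat) (a : nat -> T) :
  (forall s, a (s + N)%N = a s) -> (0 < N)%N ->
  cyclic_length d N a = \sum_(s < N.-1) d (a (m + s)%N) (a (m + s).+1)
    + d (a (m + N.-1)%N) (a (m + N.-1).+1).
Proof.
move=> aN Ngt0; rewrite /cyclic_length.
rewrite -(@sum_periodic _ (fun s => d (a s) (a s.+1)) _ m); last first.
  by move=> s; rewrite -addSn !aN.
case: N Ngt0 {aN} => // N _; rewrite big_ord_recr /= [(N + m)%N]addnC.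
by congr (_ + _); apply: eq_bigr => s _; rewrite [(s + m)%N]addnC.
Qed.

Section Walk.

Variables (R : realFieldType) (T : Type) (d : T -> T -> R).

Lemma walk_length_cons (x y : T) (p : seq T) :
  walk_length d x (y :: p) = d x y + walk_length d y p.
Proof. exact: big_cons. Qed.

Lemma walk_length_rcons_iota (a : nat -> T) (x y : T) (m N : nat) :
  walk_length d x (rcons [seq a s | s <- iota m N.+1] y) =
  d x (a m) + \sum_(s < N) d (a (m + s)%N) (a (m + s).+1) + d (a (m + N)%N) y.
Proof.
elim: N x m => [|N IHN] x m.
  by rewrite /= !walk_length_cons big_ord0 addn0 addr0 /walk_length big_nil addr0.
rewrite -[iota _ _]/(m :: iota m.+1 N.+1) /= walk_length_cons IHN.
rewrite big_ord_recl /= addn0 !addrA addSnnS; congr (_ + _ + _).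
by apply: eq_bigr => s _; rewrite !addSnnS.
Qed.

End Walk.

Lemma team_distance_periodic (R : realFieldType) (T : finType) (d : T -> T -> R)
    (S : schedule T) (t : T) (a : nat -> T) (m : nat) :
  (forall s, a (s + nb_slots T)%N = a s) -> (0 < nb_slots T)%N ->
  (forall s : 'I_(nb_slots T), venue S t s = a (s + m)%N) ->
  team_distance d S t = cyclic_length d (nb_slots T) a + d t (a m)
    + d (a (m + (nb_slots T).-1)%N) t
    - d (a (m + (nb_slots T).-1)%N) (a (m + (nb_slots T).-1).+1).
Proof.
set N := nb_slots T => aN Ngt0 aE; rewrite /team_distance.
have -> : [seq venue S t s | s <- enum 'I_N] = [seq a s | s <- iota m N].
  rewrite (eq_map aE) -[m in iota m]addn0 iotaDl -map_comp -val_enum_ord -map_comp.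
  by apply: eq_map => s /=; rewrite addnC.
rewrite (cyclic_length_recr _ m aN Ngt0) -[X in iota m X](prednK Ngt0).
by rewrite walk_length_rcons_iota; ring.
Qed.

(** As m varies, every step of the cycle is cut exactly once, and every slot is once the first and
    once the last of the route: one copy of the cycle is lost and two sums of distances to home are
    gained. *)
Lemma sum_team_distance_periodic (R : realFieldType) (T : finType) (d : T -> T -> R)
    (d_sym : forall i j, d i j = d j i)
    (S : nat -> schedule T) (t : T) (a : nat -> T) :
  (forall s, a (s + nb_slots T)%N = a s) -> (0 < nb_slots T)%N ->
  (forall m (s : 'I_(nb_slots T)), venue (S m) t s = a (s + m)%N) ->
  \sum_(m < nb_slots T) team_distance d (S m) t =
  (nb_slots T).-1%:R * cyclic_length d (nb_slots T) a
  + 2 * \sum_(s < nb_slots T) d t (a s).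
Proof.
set N := nb_slots T => aN Ngt0 aE.
rewrite (eq_bigr _ (fun (m : 'I_N) _ => team_distance_periodic d aN Ngt0 (aE m))).
rewrite sumrB !big_split /= sumr_const card_ord -/N.
rewrite (@sum_periodic _ (fun s => d (a s) t) N N.-1); last by move=> s; rewrite aN.
rewrite (@sum_periodic _ (fun s => d (a s) (a s.+1)) N N.-1); last first.
  by move=> s; rewrite -addSn !aN.
rewrite -/(cyclic_length d N a) -[X in _ *+ X](prednK Ngt0) mulrS -mulr_natl.
rewrite [X in _ + X - _](eq_bigr (fun s : 'I_N => d t (a s))) => [|s _ //].
ring.
Qed.

(** * Travel of a single team in the shifted schedules *)

Section KdrrTeam.

Variables (R : realFieldType) (T : finType) (d : T -> T -> R).
Hypotheses (n_ge4 : (4 <= #|T|)%N) (n_even : ~~ odd #|T|).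
Hypotheses (d_ge0 : forall i j, 0 <= d i j) (d_refl : forall i, d i i = 0)
  (d_sym : forall i j, d i j = d j i)
  (d_triangle : forall i j k, d i k <= d i j + d j k).
Variables (vstar : T) (c : seq T).
Hypotheses (c_uniq : uniq c) (c_all : c =i [set~ vstar]).

Let n := #|T|.
Let M := n.-1.
Let N := nb_slots T.
Let team := team_named vstar c.

(** The unshifted schedule is extended periodically to all naturals, so that a cyclic shift becomes
    a translation by m. *)
Definition periodic_venue (t s : nat) : T :=
  let s' := (s %% N)%N in
  team (if plays_home n t s' then t else Kstar n t (s' %% n.-1)).

Let Mgt0 : (0 < M)%N. Proof. by rewrite /M /n; lia. Qed.
Let Ngt0 : (0 < N)%N. Proof. by rewrite double_gt0. Qed.
Let NE : N = (M + M)%N. Proof. by rewrite /N /nb_slots -addnn. Qed.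

Lemma periodic_venueD t s : periodic_venue t (s + N) = periodic_venue t s.
Proof. by rewrite /periodic_venue modnDr. Qed.

Lemma sum_periodic_venue (F : T -> R) t : (t < n)%N -> F (team t) = 0 ->
  \sum_(s < N) F (periodic_venue t s) = \sum_v F v.
Proof.
move=> tn F0.
rewrite -(sum_venue (Kdrr_double_round_robin n_ge4 n_even c_uniq c_all 0) F0).
by apply: eq_bigr => s _; rewrite venue_Kdrr // addn0.
Qed.

Lemma sum_team_distance_Kdrr t : (t < n)%N ->
  \sum_(m < N) team_distance d (Kdrr vstar c m) (team t) =
  N.-1%:R * cyclic_length d N (periodic_venue t) + 2 * \sum_v d (team t) v.
Proof.
move=> tn; rewrite (sum_team_distance_periodic (a := periodic_venue t) d_sym) //.
- by rewrite sum_periodic_venue.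
- exact: periodic_venueD.
- by move=> m s; rewrite venue_Kdrr.
Qed.

(** Slots are counted from 2 t, where team t meets team n - 1; from there its opponents come in tour
    order t + 1, t + 2, and so on. *)
Lemma Kstar_shift t s : (t < M)%N ->
  Kstar n t ((s + t.*2) %% M) = if (M %| s)%N then M else ((s + t) %% M)%N.
Proof.
move=> tM; rewrite /Kstar -/M ltn_eqF // modn_mod -addnn.
rewrite -{2}[(t + t)%N]add0n eqn_modDr mod0n -/(dvdn _ _); case: ifP => // _.
rewrite -addnBA ?(ltnW tM) // modnDml.
by have -> : (s + (t + t) + (M - t) = s + t + M)%N; [lia | rewrite modnDr].
Qed.

(** The home block has n - 1 slots in both cases; whether it starts at 0 or 1 decides which of the
    two games against [vstar], at offsets 0 and n - 1, is away. *)
Lemma plays_home_period t s : (t < M)%N -> (s < N)%N ->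
  plays_home n t ((s + t.*2) %% N) = if (t < n./2)%N then (s < M)%N else (0 < s <= M)%N.
Proof.
rewrite NE => tM sN; rewrite modn_lt_double; last by lia.
rewrite /plays_home -/M tM; move: n_ge4 n_even; rewrite -/n /M in tM sN *.
by move=> *; case: (ltnP t n./2) => ?; case: ltnP => ?; lia.
Qed.

(** One period is a home stand followed by an away trip along the rest of the tour, with [vstar] as
    first or last stop of the trip, hence next to home. *)
Lemma periodic_venue_shift t s : (t < M)%N -> (s < N)%N ->
  periodic_venue t (s + t.*2) =
  if (t < n./2)%N && (s == M) || (n./2 <= t)%N && (s == 0%N) then vstar
  else if (s <= M)%N then team t else team ((s + t) %% M)%N.
Proof.
move=> tM sN; rewrite /periodic_venue plays_home_period // modn_dvdm; last first.
  by rewrite NE addnn -muln2 dvdn_mulr.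
rewrite Kstar_shift //.
have teamM : team M = vstar := team_last c_uniq c_all.
have Ms : (M %| s)%N = (s == M) || (s == 0%N).
  by rewrite /dvdn modn_lt_double -?NE //; rewrite NE in sN; case: ltnP; lia.
rewrite Ms; case: (ltnP t n./2) => th /=; case: (ltngtP s M) => sM /=;
  rewrite ?orbF ?orbT ?andbT ?andbF //.
- by rewrite gtn_eqF // (leq_ltn_trans _ sM).
- by case: (posnP s) => // _; rewrite teamM.
- by rewrite gtn_eqF // (leq_ltn_trans _ sM).
- by rewrite sM Mgt0 gtn_eqF.
Qed.

Lemma cyclic_length_venue t : (t < M)%N ->
  cyclic_length d N (periodic_venue t)
  <= cyclic_length d M (fun k => team (k %% M)%N) + 2 * d vstar (team t).
Proof.
have MN : (M < N)%N by rewrite NE -{1}[M]addn0 ltn_add2l.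
move=> tM; set f := d vstar (team t).
(* b is the venue sequence with v*, met only at the slots z, replaced by team t:
   it rests at team t, then follows the tour once. *)
pose b s := if (s <= M)%N then team t else team ((s + t) %% M)%N.
(* [z] also admits N, which stands for slot 0 again, because the last step of the period ends
   there. *)
pose z s := (t < n./2)%N && (s == M) || (n./2 <= t)%N && ((s == 0%N) || (s == N)).
have aE s : (s <= N)%N -> periodic_venue t (s + t.*2) = if z s then vstar else b s.
  rewrite leq_eqVlt => /orP[/eqP->|sN]; last first.
    by rewrite periodic_venue_shift // /z (ltn_eqF sN) orbF.
  rewrite addnC periodic_venueD -[t.*2]add0n periodic_venue_shift // /z !eqxx orbT /b.
  rewrite [_ == M in LHS]ltn_eqF // [N == M]gtn_eqF //.
  rewrite !andbF !andbT /= [(N <= M)%N]leqNgt MN /= NE.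
  by rewrite -addnA !modnDl modn_small.
have bM s : b (M + s)%N = team ((s + t) %% M)%N.
  rewrite /b -{2}[M]addn0 leq_add2l leqn0 -addnA modnDl.
  by case: eqP => // ->; rewrite modn_small.
have bz s : (s <= N)%N -> z s -> b s = team t.
  move=> sN; rewrite /b; case: (leqP s M) => // Ms.
  rewrite /z [s == M]gtn_eqF // [s == 0%N]gtn_eqF ?(leq_ltn_trans _ Ms) // andbF /=.
  by case/andP=> _ /eqP->; rewrite NE -addnA !modnDl modn_small.
rewrite {1}/cyclic_length -(@sum_periodic _
  (fun s => d (periodic_venue t s) (periodic_venue t s.+1)) N t.*2); last first.
  by move=> s /=; rewrite -addSn !periodic_venueD.
(* Where the true sequence is at [vstar], [b] is at team t, so each such endpoint costs at most f by
   the triangle inequality. *)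
have step (s : 'I_N) : d (periodic_venue t (s + t.*2)) (periodic_venue t (s + t.*2).+1)
    <= d (b s) (b s.+1) + ((z s)%:R + (z s.+1)%:R) * f.
  have sN := ltn_ord s.
  rewrite -addSn !aE ?(ltnW sN) //.
  case: ifPn => zs; case: ifPn => zs1.
  - rewrite (bz _ _ zs) ?(ltnW sN) // (bz _ _ zs1) // !d_refl /f.
    by rewrite add0r mulr_ge0 ?addr_ge0 ?ler0n.
  - by rewrite (bz _ _ zs) ?(ltnW sN) // addr0 mul1r addrC d_triangle.
  - by rewrite (bz _ _ zs1) // add0r mul1r [f]d_sym d_triangle.
  - by rewrite addr0 mul0r addr0.
apply: le_trans (ler_sum _ (fun s _ => step s)) _.
rewrite big_split /= -mulr_suml; apply: lerD.
  rewrite NE big_split_ord /= big1 => [|s _]; last first.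
    by rewrite /b ltn_ord (ltnW (ltn_ord s)) d_refl.
  rewrite add0r /cyclic_length -(@sum_periodic _
    (fun k => d (team (k %% M)%N) (team (k.+1 %% M)%N)) M t).
    by apply: ler_sum => s _; rewrite -addnS !bM.
  by move=> s; rewrite -addSn !modnDr.
apply: ler_wpM2r; first exact: d_ge0.
rewrite big_split /= -!natr_sum -natrD ler_nat.
(* At most one step starts at a slot of [z] and at most one ends there, whence the factor 2. *)
have one (k : nat) (P : pred nat) : (forall s, (s < N)%N -> P s -> s = k) ->
    (\sum_(i < N) P i <= 1)%N.
  move=> Pk.
  apply: (@leq_trans (\sum_(i < N) (i == k :> nat))%N).
    by apply: leq_sum => i _; case: (boolP (P i)) => // /Pk ->; rewrite ?eqxx.
  rewrite -big_mkcond /= sum1_card.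
  apply/card_le1_eqP => i j; rewrite !unfold_in => /eqP iE /eqP jE.
  by apply: val_inj; rewrite /= iE jE.
rewrite -[2%N]/(1 + 1)%N leq_add //.
  apply: (one (if t < n./2 then M else 0)%N) => s sN.
  rewrite /z (ltn_eqF sN) orbF; case: (ltnP t n./2) => /=; rewrite ?andbF ?orbF.
    by move=> _ /eqP.
  by move=> _ /eqP.
apply: (one (if t < n./2 then M.-1 else N.-1)%N (fun s => z s.+1)) => s sN.
by rewrite /z; case: (ltnP t n./2) => _ /=; rewrite ?orbF => /eqP <-.
Qed.

(** Bounding each step by a detour through home counts the venue of each opponent twice. *)
Lemma cyclic_length_star :
  cyclic_length d N (periodic_venue M) <= 2 * \sum_v d vstar v.
Proof.
have teamM : team M = vstar := team_last c_uniq c_all.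
have nM : (M < n)%N by rewrite prednK // ltnW // ltnW // ltnW.
rewrite -(sum_periodic_venue nM) ?teamM ?d_refl //.
rewrite mulr_natl mulr2n -{2}(@sum_periodic _ (fun s => d vstar (periodic_venue M s)) N 1).
  rewrite -big_split /=; apply: ler_sum => s _; rewrite addn1.
  by rewrite [in X in _ <= X + _]d_sym d_triangle.
by move=> s; rewrite periodic_venueD.
Qed.

End KdrrTeam.

(** * Pairwise distances measured along a tour *)

Section TourSum.

Variables (R : realFieldType) (T : finType) (d : T -> T -> R).
Hypotheses (d_refl : forall i, d i i = 0)
  (d_sym : forall i j, d i j = d j i)
  (d_triangle : forall i j k, d i k <= d i j + d j k).

Lemma sum_pairwise_le (h : nat) (H : nat -> T) :
  (forall i, H (i + h.*2)%N = H i) ->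
  \sum_(i < h.*2) \sum_(j < h.*2) d (H i) (H j)
  <= (h * h)%:R * cyclic_length d h.*2 H.
Proof.
move=> Hn; set n := h.*2; set L := cyclic_length d n H.
(* D k, the distances between vertices k steps apart, is at most k L in either
   direction around the tour, and sum_k min(k, 2h - k) = h^2. *)
pose D k := \sum_(i < n) d (H i) (H (i + k)%N).
have -> : \sum_(i < n) \sum_(j < n) d (H i) (H j) = \sum_(k < n) D k.
  rewrite exchange_big /= exchange_big /D [in RHS]exchange_big /=.
  apply: eq_bigr => i _.
  rewrite -(@sum_periodic _ (fun j => d (H i) (H j)) n i).
    by apply: eq_bigr => k _; rewrite addnC.
  by move=> s; rewrite Hn.
have D0 : D 0%N = 0 by rewrite /D big1 // => i _; rewrite addn0 d_refl.
have DS k : D k.+1 <= D k + L.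
  rewrite /D /L /cyclic_length -(@sum_periodic _ (fun s => d (H s) (H s.+1)) n k).
    rewrite -big_split /=; apply: ler_sum => i _; rewrite addnS; exact: d_triangle.
  by move=> s; rewrite -addSn !Hn.
have Dle k : D k <= k%:R * L.
  elim: k => [|k IHk]; first by rewrite D0 mul0r.
  by rewrite mulrS mulrDl mul1r addrC (le_trans (DS k)) // lerD2r.
have Dsym k : (k <= n)%N -> D (n - k)%N = D k.
  move=> kn; rewrite /D -(@sum_periodic _ (fun i => d (H i) (H (i + (n - k))%N)) n k).
    apply: eq_bigr => i _; rewrite d_sym; congr (d _ _).
    by rewrite -addnA subnKC // Hn.
  by move=> s; rewrite addnAC !Hn.
(* The second half, k >= h, is reversed and reflected by [Dsym], so that its step counts become 1,
   ..., h. *)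
have -> : \sum_(k < n) D k = \sum_(k < h) D k + \sum_(k < h) D k.+1.
  rewrite /n -addnn big_split_ord /=; congr (_ + _).
  rewrite (reindex_inj rev_ord_inj) /=; apply: eq_bigr => k _.
  have kh := ltn_ord k; rewrite -[RHS]Dsym; last by rewrite /n; lia.
  by congr D; rewrite /n; lia.
apply: (@le_trans _ _ (\sum_(k < h) (k%:R * L) + \sum_(k < h) (k.+1%:R * L))).
  by apply: lerD; apply: ler_sum => k _.
rewrite -!mulr_suml -mulrDl -big_split /= -[X in X * _ <= _](_ : (h * h)%:R = _) //.
(* The numbers k + (k + 1) for k < h are the first h odd numbers, with sum h^2. *)
elim: h {Hn n L D D0 DS Dle Dsym} => [|h IHh]; first by rewrite big_ord0.
rewrite big_ord_recr /= -IHh -!natrD; congr _%:R; lia.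
Qed.

End TourSum.

(** * Tours *)

(** Edges are listed as in [circuit_edges], and vertices may repeat, so that Eulerian circuits and
    Hamilton cycles are measured alike. *)
Definition tour_length (R : realFieldType) (T : Type) (d : T -> T -> R)
    (w : seq T) : R :=
  \sum_(p <- zip w (rot 1 w)) d p.1 p.2.

Lemma nth_rot1 (T : Type) (x : T) (w : seq T) (i : nat) :
  (i < size w)%N -> nth x (rot 1 w) i = nth x w (i.+1 %% size w)%N.
Proof.
case: w => // y p; rewrite rot1_cons nth_rcons /= ltnS leq_eqVlt.
case/orP=> [/eqP->|ip]; first by rewrite ltnn eqxx modnn.
by rewrite ip modn_small.
Qed.

Section TourLength.

Variables (R : realFieldType) (T : Type) (d : T -> T -> R).

Lemma tour_length_cyclic (x : T) (w : seq T) :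
  tour_length d w = cyclic_length d (size w) (fun k => nth x w (k %% size w)%N).
Proof.
have Ew : size w = size (rot 1 w) by rewrite size_rot.
rewrite /tour_length /cyclic_length (big_nth (x, x)) size_zip -Ew minnn big_mkord.
by apply: eq_bigr => i _; rewrite nth_zip //= nth_rot1 // (modn_small (ltn_ord i)).
Qed.

Lemma tour_length_rot (k : nat) (w : seq T) : tour_length d (rot k w) = tour_length d w.
Proof.
have rot1E v : tour_length d (rot 1 v) = tour_length d v.
  case: v => // x p; set v := x :: p; rewrite !(tour_length_cyclic x) size_rot.
  rewrite /cyclic_length.
  rewrite -(@sum_periodic _
    (fun s => d (nth x v (s %% size v)) (nth x v (s.+1 %% size v))) _ 1).
    apply: eq_bigr => i _; rewrite !nth_rot1 ?ltn_mod // addn1.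
    by rewrite -[(i %% _).+1]addn1 -[(i.+1 %% _).+1]addn1 !modnDml !addn1.
  by move=> s; rewrite -addSn !modnDr.
elim: k => [|k IHk]; first by rewrite rot0.
case: (ltnP k (size w)) => kw; first by rewrite rotS // rot1E.
by rewrite rot_oversize // leqW.
Qed.

Lemma tour_length_cons (x : T) (p : seq T) :
  tour_length d (x :: p) = walk_length d x (rcons p x).
Proof.
rewrite /tour_length rot1_cons /walk_length.
elim: p {1 3}x => [|y p IHp] z /=; rewrite ?big_cons ?big_nil //=.
by rewrite IHp.
Qed.

End TourLength.

Section Shortcut.

Variables (R : realFieldType) (T : eqType) (d : T -> T -> R).
Hypothesis d_triangle : forall i j k, d i k <= d i j + d j k.

Lemma walk_length_subseq (x y : T) (p q : seq T) :
  subseq p q -> walk_length d x (rcons p y) <= walk_length d x (rcons q y).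
Proof.
have tri u z v s : walk_length d u (rcons s v) <= d u z + walk_length d z (rcons s v).
  by case: s => [|a s]; rewrite /= !walk_length_cons addrA lerD2r.
elim: q p x => [|z q IHq] p x; first by rewrite subseq0 => /eqP->.
rewrite rcons_cons walk_length_cons.
case: p => [_|a p].
  by apply: le_trans (tri _ z _ [::]) _; rewrite lerD2l IHq ?sub0seq.
rewrite /=; case: eqP => [->|_] sub.
  by rewrite walk_length_cons lerD2l IHq.
by apply: le_trans (tri _ z _ (a :: p)) _; rewrite lerD2l IHq.
Qed.

Lemma tour_length_subseq (p q : seq T) :
  (forall i j, 0 <= d i j) -> subseq p q -> tour_length d p <= tour_length d q.
Proof.
move=> d_ge0; case: p => [_|x p sub].
  by rewrite /tour_length big_nil big_seq sumr_ge0.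
(* The tour q is cut at an occurrence of the first kept vertex x; what precedes it is rotated to the
   end and becomes one more stretch to skip. *)
have [q1 [q2 [-> sub2]]] : exists q1 q2, q = q1 ++ x :: q2 /\ subseq p q2.
  elim: q sub => //= z q IHq; case: eqP => [->|_] sub; first by exists [::], q.
  by have [q1 [q2 [-> sub2]]] := IHq sub; exists (z :: q1), q2.
rewrite -(tour_length_rot _ (size q1) (q1 ++ _)) rot_size_cat cat_cons !tour_length_cons.
by apply: walk_length_subseq; apply: subseq_trans sub2 (prefix_subseq _ _).
Qed.

End Shortcut.

(** * Christofides' algorithm *)

Lemma set2_eq (T : finType) (x y z t : T) :
  [set x; y] = [set z; t] -> (x = z /\ y = t) \/ (x = t /\ y = z).
Proof.
move=> /setP E; have := (E x, E y, E z, E t); rewrite !inE !eqxx !orbT /=.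
rewrite (eq_sym z x) (eq_sym z y) (eq_sym t x) (eq_sym t y) => -[[[]]].
by case: (x =P z); case: (x =P t); case: (y =P z); case: (y =P t) => //=; auto.
Qed.

Section Edges.

Variables (R : realFieldType) (T : finType) (d : T -> T -> R).
Hypotheses (d_ge0 : forall i j, 0 <= d i j) (d_refl : forall i, d i i = 0)
  (d_sym : forall i j, d i j = d j i)
  (d_triangle : forall i j k, d i k <= d i j + d j k).

Lemma edge_length_set2 (x y : T) : edge_length d [set x; y] = d x y.
Proof.
case: (eqVneq x y) => [->|]; last exact: edge_length2.
by rewrite setUid /edge_length enum_set1 d_refl.
Qed.

Lemma edge_length_ge0 (e : {set T}) : 0 <= edge_length d e.
Proof. by rewrite /edge_length; case: (enum _) => [|x [|y []]]. Qed.

Lemma eulerian_circuit_length (E M : {set {set T}}) (w : seq T) :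
  eulerian_circuit E M w ->
  tour_length d w = edges_length d E + edges_length d M.
Proof.
move=> circ; rewrite /edges_length.
rewrite -[X in _ = X + _]big_enum -[X in _ = _ + X]big_enum /= -big_cat -(perm_big _ circ).
by rewrite big_map; apply: eq_bigr => p _; rewrite edge_length_set2.
Qed.

(** Only an inequality: different indices may give the same pair, which a set of edges counts
    once. *)
Lemma edges_length_imset (I : finType) (x y : I -> T) :
  edges_length d [set [set x i; y i] | i : I] <= \sum_i d (x i) (y i).
Proof.
rewrite /edges_length; under [leRHS]eq_bigr do rewrite -edge_length_set2.
rewrite (partition_big_imset (fun i => [set x i; y i])) /=.
apply: ler_sum => _ /imsetP[i _ ->]; rewrite (bigD1 i) ?eqxx //= lerDl.
by apply: sumr_ge0 => j _; apply: edge_length_ge0.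
Qed.

(** The tour g without its closing edge; [x0] is only the default of [nth]. *)
Definition path_edges (x0 : T) (g : seq T) : {set {set T}} :=
  [set [set nth x0 g i; nth x0 g i.+1] | i : 'I_(size g).-1].

Lemma path_spanning_tree (x0 : T) (A : {set T}) (g : seq T) :
  uniq g -> g =i A -> spanning_tree A (path_edges x0 g).
Proof.
move=> g_uniq gA.
have nth_inj i j : (i < size g)%N -> (j < size g)%N -> nth x0 g i = nth x0 g j -> i = j.
  by move=> ig jg /eqP; rewrite nth_uniq // => /eqP.
have adjE x y : adjacent (path_edges x0 g) x y ->
    [/\ x \in g, y \in g & index y g = (index x g).+1 \/ index x g = (index y g).+1].
  case/imsetP=> i _ /set2_eq; have ig : (i.+1 < size g)%N by case: i => i /=; lia.
  have ig' := ltnW ig.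
  by case=> -[-> ->]; rewrite !mem_nth ?index_uniq //; split; auto.
split.
- move=> _ /imsetP[i _ ->]; have ig : (i.+1 < size g)%N by case: i => i /=; lia.
  rewrite cards2 nth_uniq ?(ltnW ig) // (ltn_eqF (ltnSn i)) andbT.
  by apply/subsetP => x; rewrite !inE => /orP[] /eqP->; rewrite -gA mem_nth // ltnW.
- have sym : connect_sym (adjacent (path_edges x0 g)).
    by apply: sym_connect_sym => x y; rewrite /adjacent setUC.
  case: g adjE gA sym {g_uniq nth_inj} => [|a p] adjE gA sym x y; rewrite -!gA //.
  have pth : path (adjacent (path_edges x0 (a :: p))) a p.
    apply/(pathP x0) => i ip; apply/imsetP; exists (Ordinal ip) => //.
  have conn := path_connect pth.
  by move=> /conn xa /conn ya; apply: connect_trans ya; rewrite sym.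
- (* On a cycle, the vertex of least index has two distinct neighbours, both of
     the next index. *)
  move=> c c_uniq c_size; apply/negP => c_cycle.
  have [x xc xmin] : exists2 x, x \in c & {in c, forall y, index x g <= index y g}%N.
    case: c c_size {c_uniq c_cycle} => // a c _.
    case: (@arg_minnP _ a (mem (a :: c)) (index^~ g)) => [|x xc xmin].
      exact: mem_head.
    by exists x.
  have [i c' ci] := rot_to xc.
  move: c_cycle c_size c_uniq xmin; rewrite -(rot_cycle i) -(size_rot i) -(rot_uniq i).
  move=> c_cycle c_size c_uniq xmin.
  have {}xmin y : y \in rot i c -> (index x g <= index y g)%N.
    by rewrite mem_rot; apply: xmin.
  case: c' ci => [|y c']; first by move=> ci; rewrite ci in c_size.
  case/lastP: c' => [|c' z] ci; first by rewrite ci in c_size.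
  move: c_cycle c_uniq xmin; rewrite ci /= rcons_path last_rcons.
  case/andP=> /adjE[_ yg xy] /andP[_ /adjE[zg _ zx]].
  case/andP=> _ /andP[yc' _] xmin.
  have yz : y = z.
    suff iyz : index y g = index z g by rewrite -(nth_index x0 yg) iyz nth_index.
    have := xmin y; have := xmin z; rewrite !inE !mem_rcons !mem_head !eqxx !orbT.
    by move=> /(_ isT) ? /(_ isT) ?; lia.
  by rewrite yz mem_rcons mem_head in yc'.
Qed.

(** Deleting one edge of the tour leaves a Hamilton path, which is a spanning tree. *)
Lemma min_spanning_tree_le_tour (x0 : T) (A : {set T}) (E : {set {set T}}) (g : seq T) :
  min_spanning_tree d A E -> uniq g -> g =i A -> edges_length d E <= tour_length d g.
Proof.
move=> [_ Emin] g_uniq gA; apply: le_trans (Emin _ (path_spanning_tree x0 g_uniq gA)) _.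
apply: le_trans (edges_length_imset _ _) _.
rewrite (tour_length_cyclic _ x0) /cyclic_length.
case: (size g) (erefl (size g)) => [|k] Ek; first by rewrite !big_ord0.
rewrite [leRHS]big_ord_recr /= -[leLHS]addr0; apply: lerD => //.
apply: ler_sum => i _; rewrite !modn_small // ?ltnS //; exact: ltnW.
Qed.

(** One of the two matchings into which a tour of even size splits; the other comes from
    [rot 1 q]. *)
Definition alternate_edges (x0 : T) (q : seq T) : {set {set T}} :=
  [set [set nth x0 q i.*2; nth x0 q i.*2.+1] | i : 'I_(size q)./2].

Lemma alternate_perfect_matching (x0 : T) (A : {set T}) (q : seq T) :
  uniq q -> q =i A -> ~~ odd (size q) -> perfect_matching A (alternate_edges x0 q).
Proof.
move=> q_uniq qA q_even.
have i2 (i : 'I_(size q)./2) : (i.*2.+1 < size q)%N by case: i => i /= ; lia.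
have i1 (i : 'I_(size q)./2) : (i.*2 < size q)%N by apply: ltnW.
split; last first.
  move=> _ /imsetP[i _ ->]; rewrite cards2 nth_uniq //.
  by rewrite (ltn_eqF (ltnSn _)).
apply/and3P; split.
- apply/eqP/setP => x; rewrite -qA; apply/bigcupP/idP => [[_ /imsetP[i _ ->]]|xq].
    by rewrite !inE => /orP[] /eqP->; rewrite mem_nth.
  have xi : (index x q < size q)%N by rewrite index_mem.
  have xlt : ((index x q)./2 < (size q)./2)%N by lia.
  exists [set nth x0 q (Ordinal xlt).*2; nth x0 q (Ordinal xlt).*2.+1].
    by apply/imsetP; exists (Ordinal xlt).
  rewrite !inE -{1 3}(nth_index x0 xq) !nth_uniq //=; lia.
- apply/trivIsetP => _ _ /imsetP[i _ ->] /imsetP[j _ ->] ij.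
  have {}ij : (i != j :> nat) by apply: contraNneq ij => /val_inj->.
  rewrite -setI_eq0; apply/eqP/setP => x; rewrite !inE.
  apply/negP => /andP[/orP[] /eqP-> ]; rewrite !nth_uniq //; lia.
- by apply/imsetP => -[i _ /setP/(_ (nth x0 q i.*2))]; rewrite !inE eqxx.
Qed.

Lemma sum_double (F : nat -> R) (k : nat) :
  \sum_(i < k.*2) F i = \sum_(i < k) F i.*2 + \sum_(i < k) F i.*2.+1.
Proof.
elim: k => [|k IHk]; first by rewrite !big_ord0 addr0.
by rewrite doubleS !big_ord_recr /= IHk; ring.
Qed.

(** The two alternate matchings have total length at most that of the tour, and neither is shorter
    than M. *)
Lemma min_perfect_matching_le_tour (x0 : T) (A : {set T})
    (M : {set {set T}}) (q : seq T) :
  min_perfect_matching d A M -> uniq q -> q =i A ->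
  2 * edges_length d M <= tour_length d q.
Proof.
move=> [[partM M2] Mmin] q_uniq qA.
(* The existence of M, a partition of A into pairs, forces the parity. *)
have q_even : ~~ odd (size q).
  rewrite -(card_uniqP q_uniq) (eq_card qA) (card_partition partM).
  by rewrite (eq_bigr (fun=> 2%N)) ?sum_nat_const ?oddM ?andbF // => e /M2.
have even_le := Mmin _ (alternate_perfect_matching x0 q_uniq qA q_even).
have := Mmin _ (alternate_perfect_matching x0 (q := rot 1 q) _ _ _).
rewrite rot_uniq size_rot => /(_ q_uniq _ q_even) odd_le.
have {}odd_le := odd_le (fun x => etrans (mem_rot 1 q x) (qA x)).
rewrite mulr_natl mulr2n; apply: le_trans (lerD even_le odd_le) _.
apply: le_trans (lerD (edges_length_imset _ _) (edges_length_imset _ _)) _.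
rewrite (tour_length_cyclic _ x0) /cyclic_length.
pose F i := d (nth x0 q (i %% size q)) (nth x0 q (i.+1 %% size q)%N).
have -> : \sum_(i < size q) d (nth x0 q (i %% size q)) (nth x0 q (i.+1 %% size q)) =
    \sum_(i < (size q)./2.*2) F i by rewrite even_halfK.
rewrite sum_double size_rot; apply: lerD; apply: ler_sum => i _; rewrite /F.
  by rewrite !modn_small //; case: i => i /=; lia.
by rewrite !nth_rot1 //; case: i => i /=; lia.
Qed.

(** Circuit edges come from E or M, hence lie within A. Conversely, a vertex of A is connected in
    the tree to another one, so some edge at it is on the circuit; this is where A needs two
    vertices. *)
Lemma christofides_vertices (A : {set T}) (c : seq T) :
  (1 < #|A|)%N -> christofides d A c -> uniq c /\ c =i A.
Proof.
move=> A2 [E [M [w [[[Esub Econn _] _] [[partM _] _] circ [_ c_uniq cw]]]]].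
split=> // x; rewrite cw; apply/idP/idP => [xw|xA].
  set e := [set x; nth x w ((index x w).+1 %% size w)%N].
  have : e \in circuit_edges w.
    apply/mapP; exists (x, nth x w ((index x w).+1 %% size w)%N) => //.
    apply/(nthP (x, x)); exists (index x w).
      by rewrite size_zip size_rot minnn index_mem.
    by rewrite nth_zip ?size_rot // nth_index // nth_rot1 ?index_mem.
  rewrite (perm_mem circ) mem_cat !mem_enum => /orP[/Esub/andP[/subsetP sub _]|eM].
    by apply: sub; rewrite !inE eqxx.
  have : x \in cover M by apply/bigcupP; exists e; rewrite // !inE eqxx.
  by case/and3P: partM => /eqP-> _ _; rewrite inE => /andP[].
have [y yA yx] : exists2 y, y \in A & y != x.
  have : (0 < #|A :\ x|)%N by rewrite (cardsD1 x) xA in A2.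
  by case/card_gt0P=> y; rewrite !inE => /andP[]; exists y.
case/connectP: (Econn _ _ xA yA) => -[|z p] /=.
  by move=> _ yE; rewrite yE eqxx in yx.
case/andP; rewrite {1}/adjacent => xz _ _.
have : [set x; z] \in circuit_edges w by rewrite (perm_mem circ) mem_cat mem_enum xz.
case/mapP=> -[a b] /(nthP (x, x))[i]; rewrite size_zip size_rot minnn => iw.
rewrite nth_zip ?size_rot // nth_rot1 // => -[<- <-].
move=> /set2_eq[] [-> _]; rewrite mem_nth //.
by rewrite ltn_mod; case: (size w) iw.
Qed.

(** The circuit has the length of E plus that of M. The tree is at most the tour g, and the matching
    at most half of g restricted to the odd vertices, which is no longer than g. *)
Lemma christofides_length (x0 : T) (A : {set T}) (c g : seq T) :
  christofides d A c -> uniq g -> g =i A ->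
  2 * tour_length d c <= 3 * tour_length d g.
Proof.
move=> [E [M [w [mstE mpmM circ [sub _ _]]]]] g_uniq gA.
have Ele := min_spanning_tree_le_tour x0 mstE g_uniq gA.
set O := odd_vertices A E in mpmM.
have OA x : x \in O -> x \in A by rewrite inE => /andP[].
have qO : [seq x <- g | x \in O] =i O.
  by move=> x; rewrite mem_filter gA; case: (boolP (x \in O)) => // /OA ->.
have Mle := min_perfect_matching_le_tour x0 mpmM (filter_uniq _ g_uniq) qO.
have := tour_length_subseq d_triangle d_ge0 (filter_subseq (mem O) g).
have := tour_length_subseq d_triangle d_ge0 sub.
rewrite (eulerian_circuit_length circ); move: Ele Mle.
by move: (tour_length _ _) (edges_length _ _) (edges_length _ _) => *; lra.
Qed.

End Edges.

(** * The approximation ratio *)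

(** A boolean form, so that [arg_minP] can minimize over the finite type of schedules. *)
Definition double_round_robinb (T : finType) (S : schedule T) : bool :=
  [&& [forall s, forall g : game T, (g \in S s) ==> (g.1 != g.2)],
      [forall s, forall t : T,
        #|[set g : game T in S s | (t == g.1) || (t == g.2)]| == 1%N]
    & [forall i : T, forall j : T, (i != j) ==> (#|[set s | (i, j) \in S s]| == 1%N)]].

Lemma double_round_robinP (T : finType) (S : schedule T) :
  reflect (double_round_robin S) (double_round_robinb S).
Proof.
apply: (iffP and3P) => -[games teams pairs]; split.
- by move=> s g; move/forallP/(_ s)/forallP/(_ g)/implyP: games.
- by move=> s t; move/forallP/(_ s)/forallP/(_ t)/eqP: teams.
- by move=> i j ij; move/forallP/(_ i)/forallP/(_ j)/implyP/(_ ij)/eqP: pairs.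
- by apply/forallP => s; apply/forallP => g; apply/implyP/games.
- by apply/forallP => s; apply/forallP => t; apply/eqP/teams.
- by apply/forallP => i; apply/forallP => j; apply/implyP => ij; apply/eqP/pairs.
Qed.

Lemma exists_min_total_distance (R : realFieldType) (T : finType)
    (d : T -> T -> R) (S0 : schedule T) :
  double_round_robin S0 -> exists opt, is_min_total_distance d opt.
Proof.
move=> /double_round_robinP drr0.
case: (arg_minP (total_distance d) drr0) => S /double_round_robinP drrS Smin.
exists (total_distance d S); split; first by exists S.
by move=> S' /double_round_robinP; apply: Smin.
Qed.

Lemma exists_le_average (R : realFieldType) (T : finType) (F : T -> R) (t0 : T) :
  exists t, #|T|%:R * F t <= \sum_u F u.
Proof.
case: (@arg_minP _ _ _ t0 predT F isT) => t _ tmin; exists t.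
rewrite mulr_natl -sumr_const; apply: ler_sum => u _; exact: tmin.
Qed.

Section Bounds.

Variables (R : realFieldType) (T : finType) (d : T -> T -> R).
Hypotheses (n_ge4 : (4 <= #|T|)%N) (n_even : ~~ odd #|T|).
Hypotheses (d_ge0 : forall i j, 0 <= d i j) (d_refl : forall i, d i i = 0)
  (d_sym : forall i j, d i j = d j i)
  (d_triangle : forall i j k, d i k <= d i j + d j k).

(** A team with at most average travel visits all venues, so its route shortcuts to a Hamilton tour
    that bounds the optimum from below. *)
Lemma double_round_robin_tour (S : schedule T) : double_round_robin S ->
  exists g, [/\ uniq g, g =i T & #|T|%:R * tour_length d g <= total_distance d S].
Proof.
move=> drrS; have [t0 _] : exists t0 : T, t0 \in T.
  by apply/card_gt0P; apply: leq_trans n_ge4.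
have [t avg] := exists_le_average (team_distance d S) t0.
set w := t :: [seq venue S t s | s <- enum 'I_(nb_slots T)].
exists (undup w); split; first exact: undup_uniq.
  by move=> v; rewrite mem_undup (venue_onto drrS).
apply: le_trans avg; rewrite ler_wpM2l ?ler0n //.
apply: le_trans (tour_length_subseq d_triangle d_ge0 (undup_subseq w)) _.
by rewrite tour_length_cons.
Qed.

Lemma sum_all_pairs_le (x0 : T) (g : seq T) : uniq g -> g =i T ->
  \sum_u \sum_v d u v <= (#|T|./2 * #|T|./2)%:R * tour_length d g.
Proof.
move=> g_uniq g_all.
have size_g : size g = #|T|./2.*2.
  by rewrite even_halfK // -(card_uniqP g_uniq) (eq_card g_all).
have sumE (F : T -> R) :
    \sum_v F v = \sum_(i < #|T|./2.*2) F (nth x0 g (i %% #|T|./2.*2)%N).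
  rewrite -size_g (eq_bigl (fun v => v \in g)) -?big_uniq //=.
  rewrite (big_nth x0) big_mkord.
  by apply: eq_bigr => i _; rewrite modn_small.
rewrite sumE; under eq_bigr do rewrite sumE.
rewrite (tour_length_cyclic _ x0) size_g.
apply: sum_pairwise_le => // i; by rewrite modnDr.
Qed.

Variables (vstar : T) (c : seq T).
Hypotheses (c_uniq : uniq c) (c_all : c =i [set~ vstar]).

Lemma sum_team (F : T -> R) :
  \sum_v F v = \sum_(i < #|T|.-1) F (team_named vstar c i) + F vstar.
Proof.
rewrite (bigD1 vstar) //= addrC; congr (_ + _).
rewrite (eq_bigl (fun v => v \in c)) -?big_uniq //=; last by move=> v; rewrite c_all !inE.
rewrite (big_nth vstar) big_mkord (size_tour c_uniq c_all).
by apply: eq_bigr => i _; rewrite /team_named nth_rcons (size_tour c_uniq c_all) ltn_ord.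
Qed.

Lemma tour_length_team :
  tour_length d c = cyclic_length d #|T|.-1
    (fun k => team_named vstar c (k %% #|T|.-1)%N).
Proof.
have Mgt0 : (0 < #|T|.-1)%N by lia.
rewrite (tour_length_cyclic _ vstar) (size_tour c_uniq c_all) /cyclic_length.
apply: eq_bigr => i _.
by rewrite /team_named !nth_rcons !(size_tour c_uniq c_all) !ltn_mod Mgt0.
Qed.

Lemma sum_total_distance_Kdrr :
  \sum_(m < nb_slots T) total_distance d (Kdrr vstar c m)
  <= (nb_slots T).-1%:R * (#|T|.-1%:R * tour_length d c + 4 * \sum_v d vstar v)
     + 2 * \sum_u \sum_v d u v.
Proof.
have teamM := team_last c_uniq c_all.
have nM : (#|T|.-1 < #|T|)%N by lia.
have sum_td t : (t < #|T|)%N -> _ :=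
  @sum_team_distance_Kdrr R T d n_ge4 n_even d_refl d_sym vstar c c_uniq c_all t.
rewrite /total_distance exchange_big /= sum_team.
rewrite (eq_bigr _ (fun (t : 'I_#|T|.-1) _ => sum_td t (ltn_trans (ltn_ord t) nM))).
rewrite -[X in _ + \sum_(i < _) team_distance d _ X]teamM sum_td // teamM.
rewrite (sum_team (fun u => \sum_v d u v)) big_split /= -!mulr_sumr.
(* The detours through [vstar] sum to 2 Delta over the other teams, and the team of [vstar] adds 2
   Delta more, whence the coefficient 4. *)
rewrite [leRHS](_ : _ = (nb_slots T).-1%:R *
    (\sum_(i < #|T|.-1) (tour_length d c + 2 * d vstar (team_named vstar c i))
     + 2 * \sum_v d vstar v)
  + 2 * (\sum_(i < #|T|.-1) \sum_v d (team_named vstar c i) v)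
  + 2 * \sum_v d vstar v); last first.
  rewrite big_split /= sumr_const card_ord -mulr_sumr (sum_team (d vstar)) d_refl.
  rewrite -[_ *+ _.-1]mulr_natl.
  by ring.
set Q := \sum_(i < _) _; set P := \sum_(i < _) _; set D := \sum_v _.
set P' := \sum_(i < _) _; set k := (nb_slots T).-1%:R; set C := cyclic_length _ _ _.
suff : k * (P + C) <= k * (P' + 2 * D) by move=> ?; lra.
apply: ler_wpM2l; first exact: ler0n.
apply: lerD; last exact: cyclic_length_star.
apply: ler_sum => t _; rewrite tour_length_team; exact: cyclic_length_venue.
Qed.

End Bounds.

Theorem theorem2 (R : realFieldType) (T : finType) (d : T -> T -> R)
  (n_ge4 : (4 <= #|T|)%N) (n_even : ~~ odd #|T|)
  (d_ge0 : forall i j, 0 <= d i j)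
  (d_refl : forall i, d i i = 0)
  (d_sym : forall i j, d i j = d j i)
  (d_triangle : forall i j k, d i k <= d i j + d j k)
  (S : schedule T) (S_output : uttp_output d S) :
  double_round_robin S /\
  exists2 opt : R, is_min_total_distance d opt
    & total_distance d S <= 11 / 4 * opt.
Proof.
case: S_output => vstar [c [m [center chr -> m_best]]].
have [c_uniq c_all] : uniq c /\ c =i [set~ vstar].
  by apply: christofides_vertices chr; rewrite cardsC1; lia.
have drr := Kdrr_double_round_robin n_ge4 n_even c_uniq c_all m.
split=> //; have [opt opt_min] := exists_min_total_distance d drr.
exists opt => //; case: opt_min => -[Sopt drr_opt <-] _.
have [g [g_uniq g_all opt_ge]] :=
  double_round_robin_tour n_ge4 d_ge0 d_triangle drr_opt.
have Wle := sum_all_pairs_le n_even d_refl d_sym d_triangle vstar g_uniq g_all.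
have le_c : 2 * tour_length d c <= 3 * tour_length d g.
  (* The algorithm builds its tour without [vstar], so the comparison tour g is shortcut past it. *)
  have g_A : [seq v <- g | v != vstar] =i [set~ vstar].
    by move=> v; rewrite mem_filter g_all !inE andbT.
  apply: le_trans (christofides_length d_ge0 d_refl d_sym d_triangle
    vstar chr (filter_uniq _ g_uniq) g_A) _.
  by rewrite ler_pM2l ?ltr0n // tour_length_subseq // filter_subseq.
(* The least star sum is at most the average one. *)
have star_le : #|T|%:R * \sum_v d vstar v <= \sum_u \sum_v d u v.
  have sumE u : \sum_v d u v = \sum_(v | v != u) d u v.
    by rewrite (bigD1 u) //= d_refl add0r.
  by rewrite mulr_natl -sumr_const; apply: ler_sum => u _; rewrite !sumE center.
have avg := sum_total_distance_Kdrr n_ge4 n_even d_ge0 d_refl d_sym d_triangle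
  c_uniq c_all.
have : (nb_slots T)%:R * total_distance d (Kdrr vstar c m)
    <= \sum_(m' < nb_slots T) total_distance d (Kdrr vstar c m').
  rewrite mulr_natl -[X in _ *+ X]card_ord -sumr_const.
  by apply: ler_sum => m' _; apply: m_best.
move=> /le_trans/(_ avg) {avg}.
have L_ge0 : 0 <= tour_length d g by apply: sumr_ge0.
move: n_ge4 opt_ge Wle star_le le_c L_ge0.
move: (total_distance d Sopt) (total_distance d (Kdrr vstar c m)) => O X.
have [h nE] : exists h, #|T| = h.*2 by exists #|T|./2; rewrite even_halfK.
have -> : nb_slots T = (4 * h - 2)%N by rewrite /nb_slots nE; lia.
rewrite nE doubleK => h_ge4.
have h_ge2 : (2 <= h)%N by lia.
have -> : (4 * h - 2).-1%:R = 4 * h%:R - 3 :> R.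
  have -> : ((4 * h - 2).-1 = 4 * h - 3)%N by lia.
  by rewrite natrB ?natrM //; lia.
have -> : (4 * h - 2)%:R = 4 * h%:R - 2 :> R by rewrite natrB ?natrM //; lia.
have -> : h.*2.-1%:R = 2 * h%:R - 1 :> R.
  have -> : (h.*2.-1 = 2 * h - 1)%N by lia.
  by rewrite natrB ?natrM //; lia.
have -> : h.*2%:R = 2 * h%:R :> R by rewrite -mul2n natrM.
have : 2 <= h%:R :> R by rewrite ler_nat.
rewrite natrM; move: h%:R (tour_length d g) (tour_length d c) (\sum_u \sum_v d u v)
  (\sum_v d vstar v).
move=> r L tau W D r_ge2 O_ge W_le D_le tau_le L_ge0 X_le.
have r_gt0 : 0 < r by lra.
(* Divide 2 r D <= W <= r^2 L by r. *)
have {}D_le : 2 * D <= r * L.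
  by rewrite -(ler_pM2l r_gt0); lra.
(* [lra] is linear, so the products of the bounds with polynomials in r are supplied by hand. *)
have coef_ge0 : 0 <= (4 * r - 3) * (2 * r - 1) by apply: mulr_ge0; lra.
have tau_ub := ler_wpM2l coef_ge0 tau_le.
have coef_ge0' : 0 <= 4 * r - 3 by lra.
have D_ub := ler_wpM2l coef_ge0' D_le.
have N_gt0 : 0 < 4 * r - 2 by lra.
rewrite -(ler_pM2l N_gt0).
have O_ub := ler_wpM2l (ltW N_gt0) O_ge.
(* The bounds leave (22 r^2 - 21 r + 9/2) L against (22 r^2 - 11 r) L. The gap (10 r - 9/2) L is a
   nonnegative combination of (r - 2) L and L. *)
have rL : 0 <= (r - 2) * L by apply: mulr_ge0; lra.
lra.
Qed.
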